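(* A commutative ring corresponds to a point of the $(Int,IntClo)$ factorisation system if and only if it is an algebraically closed field.
   Context: $CRings$ is the category of commutative unital rings. For a ring map $A\to B$, an element $b\in B$ is integral over $A$ if it is a root of a monic polynomial with coefficients in $A$. $Int$ is the class of integral maps (ring maps $A\to B$, not necessarily injective, such that every element of $B$ is integral over $A$). $IntClo$ is the class of integrally closed monomorphisms (injective maps $A\subset B$ such that every element of $B$ integral over $A$ is in $A$). $(Int,IntClo)$ is a unique factorisation system on $CRings$ with left class $Int$. A ring $A$ corresponds to a point of this system if $A\neq0$ and every finitely presented integral map $A\to B$ with $B\ne0$ admits a retraction $B\to A$. *)

(* Defs.v *)
From HB Require Import structures.
From mathcomp Require Import all_boot all_algebra.
From mathcomp.multinomials Require Import mpoly.

Set Implicit Arguments.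
Unset Strict Implicit.
Unset Printing Implicit Defensive.

Import GRing.Theory.
Local Open Scope ring_scope.

(* B is isomorphic, as an A-algebra via f, to A[X_1, .., X_n] / (g_1, .., g_m):
   evaluation at b is onto, and its kernel is the ideal generated by g. *)
Definition finitely_presented (A B : comNzRingType) (f : {rmorphism A -> B}) :
    Prop :=
  exists (n m : nat) (b : 'I_n -> B) (g : 'I_m -> {mpoly A[n]}),
    (forall y : B, exists p : {mpoly A[n]}, mmap f b p = y) /\
    (forall p : {mpoly A[n]},
       mmap f b p = 0 <->
       exists c : 'I_m -> {mpoly A[n]}, p = \sum_(i < m) c i * g i).

Definition integral_map (A B : comNzRingType) (f : {rmorphism A -> B}) : Prop :=
  integralRange f.

Definition has_retraction (A B : comNzRingType) (f : {rmorphism A -> B}) :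
    Prop :=
  exists r : {rmorphism B -> A}, cancel f r.

(* Arbitrary commutative rings are comPzRingType, so that the zero ring is
   included; polynomials require comNzRingType, hence this repackaging. *)
Definition nonzero_ring (A : comPzRingType) (A_neq0 : (1 : A) != 0) :
    comNzRingType :=
  HB.pack_for comNzRingType (GRing.ComPzRing.sort A)
    (GRing.PzSemiRing_isNonZero.Build (GRing.ComPzRing.sort A) A_neq0).

(* Taking B in comNzRingType encodes the condition B <> 0. *)
Definition int_intclo_point (A : comPzRingType) : Prop :=
  exists A_neq0 : (1 : A) != 0,
    forall (B : comNzRingType) (f : {rmorphism nonzero_ring A_neq0 -> B}),
      finitely_presented f -> integral_map f -> has_retraction f.

(* GRing.closed_field_axiom: every monic polynomial of positive degree has a
   root. *)
Definition algebraically_closed_field (A : comPzRingType) : Prop :=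
  [/\ (1 : A) != 0,
      forall x : A, x != 0 -> exists y : A, y * x = 1
    & GRing.closed_field_axiom A].

(* Main.v *)
Require Import Defs.
From HB Require Import structures.
From mathcomp Require Import all_boot all_algebra.
From mathcomp.multinomials Require Import mpoly.
From mathcomp Require Import boolp.

Set Implicit Arguments.
Unset Strict Implicit.
Unset Printing Implicit Defensive.

Import GRing.Theory.
Local Open Scope ring_scope.
Local Open Scope quotient_scope.

(** Suppose every finitely presented integral map out of [A] with nonzero
    target has a retraction. Applied to a quotient of [A[X_1, .., X_n]] by
    finitely many polynomials, a retraction sends the classes of the
    variables to a common zero of these polynomials in [A]. So
    [retractions_common_zero]: a finite system that does not generate the
    unit ideal and that contains, for each variable, a monic polynomial in
    this variable (which makes the quotient integral) has a zero in [A]. Two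
    systems suffice. A non-invertible constant [a], in no variable,
    generates a proper ideal, so it has a zero, which means [a = 0]
    ([retractions_unit]); a monic polynomial of positive degree in one
    variable generates a proper ideal, so it has a root
    ([retractions_closed]).

    Conversely let [A] be an algebraically closed field and [f : A -> B] an
    integral map with [B] nonzero, generated by [b_1, .., b_n]. The key is
    [specialize_integral]: a proper ideal [I] of [B] stays proper after
    adding [b - f c], for a suitable [c] in [A], when [b] is integral.
    Indeed [b] is killed by a product of factors [X - c_i], so if each [I +
    (b - f c_i)] contained 1, multiplying these relations together would put
    1 in [I]. Starting from the zero ideal and treating the generators one
    after the other yields a proper ideal [J] containing all [b_i - f x_i].
    Then every element of [B] is congruent modulo [J] to some [f c], and [c]
    is unique because a nonzero difference of two such would be invertible
    in [A] and its image a unit in [J]; the map taking an element to this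
    [c] is the retraction. *)

(** * Proper ideals *)

(** Membership in an [idealr] is boolean; classical logic makes every proper
    ideal given by a proposition decidable, so that the quotient construction
    applies to it. *)
Lemma idealr_of_Prop (R : comNzRingType) (P : R -> Prop) :
    P 0 -> ~ P 1 -> (forall a u v, P u -> P v -> P (a * u + v)) ->
  exists I : idealr R, forall x, x \in I <-> P x.
Proof.
move=> P0 P1 PD; pose S : R -> bool := fun x => `[< P x >].
have closedS : idealr_closed S.
  split; [exact/asboolP | exact/asboolP |].
  by move=> a u v /asboolP Pu /asboolP Pv; apply/asboolP/PD.
pose M := isIdealr.Build R S closedS.
pose I : idealr R := HB.pack S M.
by exists I => x; split=> [/asboolP | Px] //; apply/asboolP.
Qed.

Lemma adjoin_idealr (R : comNzRingType) (I : idealr R) (t : R) :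
    (forall r, 1 - r * t \notin I) ->
  exists J : idealr R, {subset I <= J} /\ t \in J.
Proof.
move=> proper_It.
have [|[r]||J memJ] := @idealr_of_Prop R (fun x => exists r, x - r * t \in I).
- by exists 0; rewrite mul0r subr0 rpred0.
- by apply/negP.
- move=> a u v [r Ir] [s Is]; exists (a * r + s).
  have -> : a * u + v - (a * r + s) * t = a * (u - r * t) + (v - s * t).
    by rewrite mulrBr mulrDl mulrA opprD addrACA.
  by rewrite rpredD // idealMr.
exists J; split=> [x Ix|]; apply/memJ; first by exists 0; rewrite mul0r subr0.
by exists 1; rewrite mul1r subrr rpred0.
Qed.

Lemma span_idealr (R : comNzRingType) m (g : 'I_m -> R) :
    (forall c : 'I_m -> R, \sum_(j < m) c j * g j <> 1) ->
  exists I : idealr R,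
    forall x, x \in I <-> exists c : 'I_m -> R, x = \sum_(j < m) c j * g j.
Proof.
move=> proper_g; apply: idealr_of_Prop.
- by exists (fun=> 0); rewrite big1 // => j _; rewrite mul0r.
- by move=> [c /esym /proper_g].
- move=> a _ _ [c ->] [d ->]; exists (fun j => a * c j + d j).
  rewrite mulr_sumr -big_split /=; apply: eq_bigr => j _.
  by rewrite mulrDl mulrA.
Qed.

Lemma idealr_congrX (B : comNzRingType) (J : idealr B) (u v : B) k :
  u - v \in J -> u ^+ k - v ^+ k \in J.
Proof. by move=> Juv; rewrite subrXX mulrC idealMr. Qed.

Lemma idealr_congrM (B : comNzRingType) (J : idealr B) (u v s t : B) :
  u - v \in J -> s - t \in J -> u * s - v * t \in J.
Proof.
move=> Juv Jst.
have -> : u * s - v * t = s * (u - v) + v * (s - t).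
  by rewrite !mulrBr addrA ![_ * u]mulrC ![_ * v]mulrC subrK.
by rewrite rpredD // idealMr.
Qed.

Lemma quotient_ring (R : comNzRingType) (I : idealr R) :
  exists (B : comNzRingType) (pi : {rmorphism R -> B}),
    (forall y, exists x, pi x = y) /\ (forall x, pi x = 0 <-> x \in I).
Proof.
exists {ideal_quot I}, \pi_{ideal_quot I}; split=> [y | x].
  by exists (repr y); apply: reprK.
have pi0 : \pi_{ideal_quot I} 0 = 0 by apply: rmorph0.
rewrite -[x in x \in I]subr0 Quotient.idealrBE pi0.
by split=> [-> | /eqP].
Qed.

(** * From retractions to zeros of polynomials *)

Definition has_fp_integral_retractions (A : comNzRingType) : Prop :=
  forall (B : comNzRingType) (f : {rmorphism A -> B}),
    finitely_presented f -> integral_map f -> has_retraction f.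

Lemma rmorph_mmap n (A B C : comNzRingType) (f : {rmorphism A -> B})
    (r : {rmorphism B -> C}) (b : 'I_n -> B) (p : {mpoly A[n]}) :
  r (mmap f b p) = mmap (r \o f) (r \o b) p.
Proof.
rewrite /mmap rmorph_sum; apply: eq_bigr => m _.
rewrite rmorphM rmorph_prod; congr (_ * _).
by apply: eq_bigr => i _; rewrite rmorphXn.
Qed.

Lemma integral_mmap n (A B : comNzRingType) (f : {rmorphism A -> B})
    (b : 'I_n -> B) (p : {mpoly A[n]}) :
  (forall i, integralOver f (b i)) -> integralOver f (mmap f b p).
Proof.
move=> int_b; rewrite /mmap.
elim/big_ind: _ => [|u v|m _]; [exact: integral0 | exact: integral_add |].
apply: integral_mul; first exact: integral_id.
rewrite /mmap1.
elim/big_ind: _ => [|u v|i _]; [exact: integral1 | exact: integral_mul |].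
elim: (m i) => [|k IHk]; first by rewrite expr0; apply: integral1.
by rewrite exprS; apply: integral_mul.
Qed.

(** The quotient [B] of the polynomial ring by the [g j] is integral over [A]
    because each variable satisfies a monic equation there. A retraction
    [r : B -> A] composed with the projection is an [A]-algebra map to [A],
    i.e. evaluation at a point, and it kills each [g j]. *)
Lemma retractions_common_zero (A : comNzRingType) n m
    (g : 'I_m -> {mpoly A[n]}) :
    has_fp_integral_retractions A ->
    (forall c : 'I_m -> {mpoly A[n]}, \sum_(j < m) c j * g j <> 1) ->
    (forall i, exists j, exists2 h : {poly A},
       h \is monic & g j = (map_poly (@mpolyC n A) h).['X_i]) ->
  exists x : 'I_n -> A, forall j, (g j).@[x] = 0.
Proof.
move=> ptA /span_idealr[I memI] mon_g.
have [B [pi [surj_pi ker_pi]]] := quotient_ring I.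
pose f : {rmorphism A -> B} := pi \o @mpolyC n A.
pose b i := pi 'X_i.
have piE p : mmap f b p = pi p.
  rewrite {2}[p]mpolyE rmorph_sum; apply: eq_bigr => k _.
  by rewrite -mul_mpolyC rmorphM mpolyXE_id rmorph_prod; congr (_ * _);
    apply: eq_bigr => i _; rewrite rmorphXn.
have pi_g j : pi (g j) = 0.
  apply/ker_pi/memI; exists (fun k => (k == j)%:R).
  rewrite (bigD1 j) //= eqxx mul1r big1 ?addr0 // => k /negPf->.
  by rewrite mul0r.
have fpf : finitely_presented f.
  exists n, m, b, g; split=> [y|p].
    by have [p <-] := surj_pi y; exists p.
  by rewrite piE; apply: iff_trans (ker_pi p) (memI p).
have intf : integral_map f.
  move=> y; have [p <-] := surj_pi y; rewrite -piE.
  apply: integral_mmap => i; have [j [h mon_h gE]] := mon_g i.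
  exists h => //.
  by rewrite map_poly_comp /root /b horner_map -gE pi_g.
have [r rK] := ptA B f fpf intf.
exists (r \o b) => j.
have -> : (g j).@[r \o b] = r (mmap f b (g j)).
  rewrite rmorph_mmap; apply: eq_bigr => k _; congr (_ * _).
  by rewrite /= rK.
by rewrite piE pi_g rmorph0.
Qed.

(** With no variable the quotient is [A / (a)], and a constant polynomial has a
    zero only if it is 0; so [A / (a)] is trivial when [a] is nonzero. *)
Lemma retractions_unit (A : comNzRingType) :
    has_fp_integral_retractions A ->
  forall a : A, a != 0 -> exists y, y * a = 1.
Proof.
move=> ptA a /eqP a0; apply: contra_notP a0 => noinv.
pose z (_ : 'I_0) : A := 0.
have [|[]//|x /(_ ord0)] := @retractions_common_zero A 0 1 (fun=> a%:MP) ptA.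
- move=> c; rewrite big_ord1 => /(congr1 (meval z)).
  rewrite mevalM mevalC meval1 => c1; apply: noinv.
  by exists (meval z (c ord0)).
by rewrite mevalC.
Qed.

(** The monic equation to solve is itself the integrality relation required of
    the single variable. *)
Lemma retractions_closed (A : comNzRingType) :
    has_fp_integral_retractions A ->
  GRing.closed_field_axiom A.
Proof.
move=> ptA d P d_gt0.
pose q := \poly_(i < d) P i; pose h := 'X^d - q.
have size_h : size h = d.+1.
  by rewrite size_polyDl size_polyXn // size_polyN ltnS size_poly.
have mon_h : h \is monic.
  rewrite monicE lead_coefDl ?lead_coefXn //.
  by rewrite size_polyN size_polyXn ltnS size_poly.
have [||x /(_ ord0)] := @retractions_common_zero A 1 1
  (fun=> (map_poly (@mpolyC 1 A) h).['X_ord0]) ptA.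
- move=> c; rewrite big_ord1 => /(congr1 (mmap polyC (fun=> 'X))).
  rewrite rmorphM rmorph1 /=.
  (* Under the isomorphism of polynomials in one indexed variable with
     univariate ones, a relation making the ideal improper would exhibit 1 as a
     multiple of a monic polynomial of positive degree. *)
  have -> : mmap polyC (fun=> 'X) (map_poly (@mpolyC 1 A) h).['X_ord0] = h.
    rewrite -horner_map -map_poly_comp /= mmapX mmap1U.
    rewrite -[RHS]comp_polyXr; congr (_.[_]).
    by apply: eq_map_poly => a /=; rewrite mmapC.
  set u := mmap _ _ _ => uh1.
  have u0 : u != 0.
    by apply: contra_eq_neq uh1 => ->; rewrite mul0r eq_sym oner_neq0.
  move/(congr1 (size : {poly A} -> nat)): uh1.
  rewrite size_Mmonic // size_h size_poly1 addnS /=.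
  rewrite -size_poly_gt0 in u0 => sz; by have := leq_add u0 d_gt0; rewrite sz.
- by move=> i; rewrite (ord1 i); exists ord0, h.
rewrite /= -horner_map -map_poly_comp /= mevalXU => hx.
exists (x ord0); apply/eqP; rewrite -subr_eq0; apply/eqP.
move: hx; rewrite (eq_map_poly (g := idfun)) => [|a]; last by rewrite /= mevalC.
rewrite map_poly_id // /h hornerD hornerN hornerXn => hx.
by rewrite -horner_poly.
Qed.

(** * From an algebraically closed field to retractions *)

Lemma closed_monic_root (A : comNzRingType) (h : {poly A}) :
    GRing.closed_field_axiom A -> h \is monic -> (1 < size h)%N ->
  exists c, root h c.
Proof.
move=> closedA; rewrite monicE lead_coefE.
case size_h: (size h) => [|[|d]] //= /eqP h_lead _.
have [c cP] := closedA d.+1 (fun i => - h`_i) isT.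
exists c; apply/rootP.
rewrite horner_coef size_h big_ord_recr /= h_lead mul1r cP.
by rewrite -big_split big1 //= => i _; rewrite mulNr subrr.
Qed.

(** Induction on the degree of a monic [h] such that [h(b)] lies in [I]. Write
    [h = q * ('X - c)]. If adding [b - f c] to [I] yields the unit ideal, then
    [1 = r * (b - f c)] modulo [I]; multiplying by [q(b)] gives
    [q(b) = r * h(b) = 0] modulo [I], and [q] has smaller degree. The
    descent cannot reach [h = 1] as [I] is proper. *)
Lemma specialize_integral (A B : comNzRingType) (f : {rmorphism A -> B})
    (I : idealr B) (b : B) :
    GRing.closed_field_axiom A -> integralOver f b ->
  exists (J : idealr B) (c : A), {subset I <= J} /\ b - f c \in J.
Proof.
move=> closedA [h mon_h /rootP hb0].
have {hb0} : (map_poly f h).[b] \in I by rewrite hb0 rpred0.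
have [k] := ubnP (size h); elim: k h mon_h => // k IHk h mon_h lt_hk hbI.
have [size_h | size_h] := leqP (size h) 1.
  have h1 : h = 1.
    rewrite (size1_polyC size_h); congr (_%:P).
    move: mon_h; rewrite monicE lead_coefE => /eqP <-.
    by case: (size h) size_h => [|[]].
  by move: hbI; rewrite h1 rmorph1 hornerC idealr1.
have [c /factor_theorem[q hq]] := closed_monic_root closedA mon_h size_h.
have mon_q : q \is monic by rewrite -(monicMr _ (monicXsubC c)) -hq.
have [properJ | ] := pselect (forall r, 1 - r * (b - f c) \notin I).
  have [J [IJ Jb]] := adjoin_idealr properJ.
  by exists J, c.
move/existsNP => [r /negP/negPn Ir]; apply: (IHk q mon_q).
  move: lt_hk; rewrite hq size_Mmonic ?monic_neq0 ?monicXsubC //.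
  by rewrite size_XsubC addn2.
have -> : (map_poly f q).[b] =
    (map_poly f q).[b] * (1 - r * (b - f c)) + r * (map_poly f h).[b].
  rewrite hq rmorphM hornerM /= map_polyXsubC hornerXsubC.
  by rewrite mulrBr mulr1 mulrCA subrK.
by rewrite rpredD // idealMr.
Qed.

Lemma specialize_family (A B : comNzRingType) (f : {rmorphism A -> B}) n
    (b : 'I_n -> B) :
    GRing.closed_field_axiom A -> (forall i, integralOver f (b i)) ->
  exists (J : idealr B) (x : 'I_n -> A), forall i, b i - f (x i) \in J.
Proof.
move=> closedA int_b.
suff [J Jb] : exists J : idealr B, forall i, exists c, b i - f c \in J.
  by have [x Jx] := choice Jb; exists J, x.
suff [J Jb] : exists J : idealr B,
    forall i, i \in enum 'I_n -> exists c, b i - f c \in J.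
  by exists J => i; apply: Jb; rewrite mem_enum.
elim: (enum 'I_n) => [|i s [I Ib]].
  have [||a u v /eqP-> /eqP->|J _] := @idealr_of_Prop B (fun x => x == 0).
  (* No element to specialise: the zero ideal, proper since [B] is nonzero. *)
  - exact: eqxx.
  - by rewrite oner_eq0.
  - by rewrite mulr0 addr0.
  by exists J.
have [J [c [IJ Jc]]] := specialize_integral I closedA (int_b i).
exists J => j; rewrite inE => /predU1P[-> | /Ib[d Id]]; first by exists c.
by exists d; apply: IJ.
Qed.

Lemma mmap_congr (A B : comNzRingType) (f : {rmorphism A -> B}) n
    (b : 'I_n -> B) (x : 'I_n -> A) (J : idealr B) (p : {mpoly A[n]}) :
  (forall i, b i - f (x i) \in J) -> mmap f b p - f p.@[x] \in J.
Proof.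
move=> Jx; rewrite mevalE rmorph_sum /mmap -sumrB.
apply: rpred_sum => m _; rewrite rmorphM -mulrBr idealMr // rmorph_prod /mmap1.
elim/big_ind2: _ => [|*|i _]; first by rewrite subrr rpred0.
  exact: idealr_congrM.
by rewrite rmorphXn idealr_congrX.
Qed.

(** The ideal [J] makes the composite [A -> B -> B / J] bijective; the
    retraction is the projection followed by the inverse of this bijection. *)
Lemma closed_field_retraction (A B : comNzRingType) (f : {rmorphism A -> B}) :
    (forall a : A, a != 0 -> exists y, y * a = 1) ->
    GRing.closed_field_axiom A ->
  finitely_presented f -> integral_map f -> has_retraction f.
Proof.
move=> fieldA closedA [n [m [b [g [surj_b _]]]]] intf.
have [J [x Jx]] := specialize_family closedA (fun i => intf (b i)).
have /choice[r rP] : forall y, exists c, y - f c \in J.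
  by move=> y; have [p <-] := surj_b y; exists p.@[x]; apply: mmap_congr.
have fJ0 c : f c \in J -> c = 0.
  move=> Jc; apply/eqP; apply: contraT => /fieldA[d dc1].
  by have := idealMr (f d) Jc; rewrite -rmorphM dc1 rmorph1 idealr1.
have rE y c : y - f c \in J -> r y = c.
  move=> Jyc; apply/eqP; rewrite -subr_eq0; apply/eqP/fJ0.
  rewrite rmorphB -[f (r y)](subrK y) -addrA -opprB.
  by rewrite rpredD ?rpredN.
have r_add : zmod_morphism r.
  move=> u v; apply: rE.
  have -> : u - v - f (r u - r v) = (u - f (r u)) - (v - f (r v)).
    by rewrite rmorphB !opprD addrACA.
  by rewrite rpredB.
have r_mul : monoid_morphism r.
  split=> [|u v]; apply: rE; first by rewrite rmorph1 subrr rpred0.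
  by rewrite rmorphM idealr_congrM.
pose Madd := GRing.isZmodMorphism.Build B A r r_add.
pose Mmul := GRing.isMonoidMorphism.Build B A r r_mul.
pose R : {rmorphism B -> A} := HB.pack r Madd Mmul.
by exists R => a; apply: rE; rewrite subrr rpred0.
Qed.

Theorem proposition103 (A : comPzRingType) :
  int_intclo_point A <-> algebraically_closed_field A.
Proof.
split=> [[A_neq0 ptA] | [A_neq0 fieldA closedA]].
  split=> //.
    exact: (@retractions_unit (nonzero_ring A_neq0) ptA).
  exact: (@retractions_closed (nonzero_ring A_neq0) ptA).
exists A_neq0 => B f.
exact: (@closed_field_retraction (nonzero_ring A_neq0) B f fieldA closedA).
Qed.
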